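(* Let $R$ be a finite chain ring of characteristic $p^m$ with $p$ prime and $m>1$, and let $n\ge2$. Then for any two elements $a(x),b(x)\in B_1$: $a(x)$ and $b(x)$ are $n$-isometric if and only if $a(x)$ and $b(x)$ are $n$-equivalent.
   Context: A finite chain ring $R$ is a finite commutative local ring with identity whose ideals are linearly ordered by inclusion; $R^\times$ is its group of units. $B_1=\{b_1x+b_0\mid b_1,b_0\in R^\times\}\subset R[x]$. Elements of $R[x]/\langle x^n-c(x)\rangle$ (with $\deg c<n$) are represented uniquely by polynomials of degree $<n$; the Hamming weight of an element is the number of nonzero coefficients of this representative, and the Hamming distance of two elements is the Hamming weight of their difference. For binomials $a(x),b(x)\in B_1$, $a(x)$ is $n$-isometric to $b(x)$ if there exists an $R$-algebra isomorphism $\phi:R[x]/\langle x^n-a(x)\rangle\to R[x]/\langle x^n-b(x)\rangle$ preserving the Hamming distance. They are $n$-equivalent if there exists $\alpha\in R^\times$ such that $f(x)\mapsto f(\alpha x)$ is a (well-defined) $R$-algebra isomorphism $R[x]/\langle x^n-a(x)\rangle\to R[x]/\langle x^n-b(x)\rangle$. *)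

(* Defs.v *)
From mathcomp Require Import all_boot all_order all_algebra.

Set Implicit Arguments.
Unset Strict Implicit.
Unset Printing Implicit Defensive.

Import GRing.Theory.
Local Open Scope ring_scope.

Section FiniteChainRing.

Variable R : finComUnitRingType.

(* Unlike [idealr_closed] of ring_quotient, the whole ring is allowed. *)
Definition is_ideal (I : {set R}) : Prop :=
  [/\ 0 \in I, {in I &, forall u v, u + v \in I}
    & forall r, {in I, forall u, r * u \in I}].

Definition is_maximal_ideal (M : {set R}) : Prop :=
  [/\ is_ideal M, M != [set: R]
    & forall J : {set R}, is_ideal J -> M \subset J -> J = M \/ J = [set: R]].

Definition local_ring : Prop := exists! M : {set R}, is_maximal_ideal M.

Definition finite_chain_ring : Prop :=
  local_ring /\
  (forall I J : {set R}, is_ideal I -> is_ideal J -> I \subset J \/ J \subset I).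

(* [k] is the nonnegative generator of the kernel of Z -> R; the predicate
   [pchar R] of ssralg only covers prime characteristics. *)
Definition has_characteristic (k : nat) : Prop :=
  forall j : nat, (j%:R == 0 :> R) = (k %| j)%N.

End FiniteChainRing.

Section Quotients.

Variables (R : finComUnitRingType) (n : nat).
Implicit Types a b c h : {poly R}.

Definition B1 c : Prop :=
  exists b1 b0 : R, [/\ b1 \is a GRing.unit, b0 \is a GRing.unit
                      & c = b1 *: 'X + b0%:P].

(* An element of [{poly %/ h}] is the polynomial of degree < deg h that
   represents it, provided that h is monic and nonconstant (otherwise the
   library takes the quotient by 'X). For h = 'X^n - c this holds as soon as
   0 < n and deg c < n, hence for c in [B1] and 2 <= n. *)
Definition hamming_weight h (u : {poly %/ h}) : nat :=
  count (fun x : R => x != 0) (u : {poly R}).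

Definition hamming_dist h (u v : {poly %/ h}) : nat := hamming_weight (u - v).

Definition n_isometric a b : Prop :=
  exists phi : {lrmorphism {poly %/ 'X^n - a} -> {poly %/ 'X^n - b}},
    bijective phi /\
    (forall u v, hamming_dist (phi u) (phi v) = hamming_dist u v).

(* Prescribing [phi] on the classes of all polynomials f expresses both that
   f(x) |-> f(alpha x) is well defined on the quotients and that it is [phi]. *)
Definition n_equivalent a b : Prop :=
  exists alpha : R, alpha \is a GRing.unit /\
    exists phi : {lrmorphism {poly %/ 'X^n - a} -> {poly %/ 'X^n - b}},
      bijective phi /\
      (forall f : {poly R},
         phi (in_qpoly ('X^n - a) f) =
         in_qpoly ('X^n - b) (f \Po (alpha *: 'X))).

End Quotients.

(* Main.v *)
Require Import Defs.
From mathcomp Require Import all_boot all_order all_algebra.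
From mathcomp Require Import zify ring.

Set Implicit Arguments.
Unset Strict Implicit.
Unset Printing Implicit Defensive.

Import GRing.Theory.
Local Open Scope ring_scope.

(** If [phi] is an isometry, then [phi x] has weight one, say [phi x = alpha x^k].
    For [2 <= k < n], let [j] be the least integer with [n <= j k]. Then [j < n],
    so [x^j], hence [alpha^j x^(j k)], has weight one; but [x^(j k)] reduces to
    [x^(j k - n) (b1 x + b0)], both of whose terms have degree [< n]. As [b1] and
    [b0] are units, that element has weight zero or two. The case [k = 0] violates
    injectivity, so [phi x = alpha x]; surjectivity then makes [alpha] a unit. *)

Lemma coef_comp_polyZX (R : comNzRingType) (p : {poly R}) (c : R) i :
  (p \Po (c *: 'X))`_i = p`_i * c ^+ i.
Proof.
rewrite coef_comp_poly; have [lt_ip|le_pi] := ltnP i (size p).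
  rewrite (bigD1 (Ordinal lt_ip)) //= exprZn coefZ coefXn eqxx mulr1.
  rewrite big1 ?addr0 // => j; rewrite -val_eqE /= => ne_ji.
  by rewrite exprZn coefZ coefXn eq_sym (negPf ne_ji) !mulr0.
rewrite nth_default // mul0r big1 // => j _.
rewrite exprZn coefZ coefXn gtn_eqF ?mulr0 //.
exact: leq_trans (ltn_ord j) le_pi.
Qed.

(** * Arithmetic and algebra morphisms modulo [x^n - c] with [deg c < n] *)

Section QuotientMorphisms.

Variable R : comNzRingType.
Implicit Types (f g h : {poly R}).

Lemma in_qpoly_val h (u : {poly %/ h}) : in_qpoly h u = u.
Proof. by apply/val_inj/in_qpoly_small/size_mk_monic. Qed.

(** The class of ['X] generates the quotient as an [R]-algebra, so its image determines [phi]: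
    building [f] up by Horner's scheme shows that [phi] substitutes [q]. *)
Lemma lrmorph_in_qpoly g h (phi : {lrmorphism {poly %/ g} -> {poly %/ h}}) f q :
  phi (in_qpoly g 'X) = in_qpoly h q ->
  phi (in_qpoly g f) = in_qpoly h (f \Po q).
Proof.
move=> phiX; elim/poly_ind: f => [|f c IHf]; first by rewrite comp_poly0 !raddf0.
rewrite comp_polyD comp_polyM comp_polyX comp_polyC !rmorphD !rmorphM /= IHf phiX.
by rewrite -alg_polyC !linearZ /= !rmorph1.
Qed.

Variables (n : nat) (c : {poly R}).
Hypothesis size_c : (size c <= n)%N.

Lemma size_XnsubP : size ('X^n - c) = n.+1.
Proof. by rewrite size_polyDl size_polyXn // size_polyN ltnS. Qed.

(** [mk_monic] falls back to ['X] unless its argument is monic and nonconstant; [size c <= n]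
    protects the leading term ['X^n], and [0 < n] excludes constants. *)
Lemma mk_monic_XnsubP : (0 < n)%N -> mk_monic ('X^n - c) = 'X^n - c.
Proof.
move=> n_gt0; rewrite /mk_monic size_XnsubP ltnS n_gt0 monicE lead_coefDl.
  by rewrite lead_coefXn eqxx.
by rewrite size_polyXn size_polyN ltnS.
Qed.

Lemma in_qpolyXn : (0 < n)%N -> in_qpoly ('X^n - c) 'X^n = in_qpoly ('X^n - c) c.
Proof.
move=> n_gt0; apply/eqP; rewrite -subr_eq0 -raddfB; apply/eqP/val_inj => /=.
rewrite mk_monic_XnsubP // Pdiv.RingMonic.rmodpp //.
by rewrite -mk_monic_XnsubP ?monic_mk_monic.
Qed.

Lemma in_qpoly_XnsubP f :
  (0 < n)%N -> (size f <= n)%N -> in_qpoly ('X^n - c) f = f :> {poly R}.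
Proof.
by move=> n_gt0 le_fn; rewrite in_qpoly_small // mk_monic_XnsubP // size_XnsubP.
Qed.

Lemma size_qpoly_XnsubP (u : {poly %/ 'X^n - c}) :
  (0 < n)%N -> (size (u : {poly R}) <= n)%N.
Proof.
move=> n_gt0; have sizeE : size (mk_monic ('X^n - c)) = n.+1.
  by rewrite mk_monic_XnsubP // size_XnsubP.
by rewrite -ltnS -sizeE; apply: size_mk_monic.
Qed.

End QuotientMorphisms.

(** * Counting nonzero coefficients *)

Section Weight.

Variable R : nzRingType.
Implicit Types p q : {poly R}.

(** Padding with zeros up to a common bound [N] lets weights of polynomials of different sizes be
    compared coefficient by coefficient. *)
Lemma count_coef_neq0 N p : (size p <= N)%N ->
  count (fun c : R => c != 0) p = (\sum_(i < N) (p`_i != 0)%R)%N.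
Proof.
move=> le_pN; rewrite -sum1_count (big_nth 0) big_mkord big_mkcond /=.
rewrite (big_ord_widen _ (fun i => if p`_i != 0 then 1%N else 0%N) le_pN).
rewrite big_mkcond; apply: eq_bigr => i _.
by case: ltnP => [_|le_pi]; [case: eqP | rewrite nth_default ?eqxx].
Qed.

Lemma count_coef_eq1 p : count (fun c : R => c != 0) p = 1%N ->
  exists k : nat, p = p`_k *: 'X^k.
Proof.
rewrite (count_coef_neq0 (leqnn _)) => /eqP/sum_nat_eq1[k [_ _ p_k]].
exists k; apply/polyP => i; rewrite coefZ coefXn.
have [->|ne_ik] := eqVneq i k; first by rewrite mulr1.
rewrite mulr0; have [lt_ip|] := ltnP i (size p); last exact: nth_default.
by have /eqP := p_k (Ordinal lt_ip) ne_ik isT; rewrite eqb0 negbK => /eqP.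
Qed.

Lemma count_coefZXn (c : R) k :
  count (fun c : R => c != 0) (c *: 'X^k) = (c != 0).
Proof.
have le_k : (size (c *: 'X^k) <= k.+1)%N.
  by rewrite (leq_trans (size_scale_leq _ _)) ?size_polyXn.
rewrite (count_coef_neq0 le_k) big_ord_recr big1 /= => [|i _].
  by rewrite coefZ coefXn eqxx mulr1.
by rewrite coefZ coefXn ltn_eqF ?mulr0 ?eqxx.
Qed.

End Weight.

(** * Isometry and equivalence for binomials *)

Section Binomials.

Variables (R : finComUnitRingType) (n : nat).
Hypothesis n_gt1 : (1 < n)%N.
Implicit Types a b c : {poly R}.

Let n_gt0 : (0 < n)%N := ltnW n_gt1.

Lemma size_B1 c : B1 c -> (size c <= n)%N.
Proof.
case=> b1 [b0 [_ _ ->]]; rewrite (leq_trans _ n_gt1) //.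
rewrite (leq_trans (size_polyD _ _)) // geq_max.
rewrite (leq_trans (size_scale_leq _ _)) ?size_polyX //=.
by rewrite (leq_trans (size_polyC_leq1 _)).
Qed.

(** Substituting [alpha x] multiplies the coefficient of degree [i] by the unit [alpha^i]. The size
    stays at most [n], so no reduction occurs and the support is unchanged. *)
Lemma n_equivalent_isometric a b : (size a <= n)%N -> (size b <= n)%N ->
  n_equivalent n a b -> n_isometric n a b.
Proof.
move=> sa sb [alpha [alphaU [phi [phi_bij phiE]]]]; exists phi; split=> // u v.
rewrite /hamming_dist -rmorphB /= /hamming_weight; set w := u - v.
have sw : (size (w : {poly R}) <= n)%N by exact: (size_qpoly_XnsubP sa).
have phiw : phi w = in_qpoly _ ((w : {poly R}) \Po (alpha *: 'X)).
  by rewrite -phiE in_qpoly_val.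
have sphiw : (size ((w : {poly R}) \Po (alpha *: 'X)) <= n)%N.
  apply/leq_sizeP => i le_ni.
  by rewrite coef_comp_polyZX nth_default ?mul0r // (leq_trans sw).
rewrite phiw in_qpoly_XnsubP // (count_coef_neq0 sw) (count_coef_neq0 sphiw).
apply: eq_bigr => i _; rewrite coef_comp_polyZX mulIr_eq0 //.
by apply: mulIr; rewrite unitrX.
Qed.

Lemma pow_weight_neq1 b (alpha : R) k : B1 b -> (1 < k < n)%N ->
  exists2 j, (j < n)%N &
    hamming_weight (in_qpoly ('X^n - b) ((alpha *: 'X^k) ^+ j)) <> 1%N.
Proof.
move=> bB1 /andP[k_gt1 lt_kn]; have sb := size_B1 bB1.
have k_gt0 := ltnW k_gt1.
have ex_j : exists j, (n <= j * k)%N by exists n; rewrite leq_pmulr.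
case: (ex_minnP ex_j) => j le_n_jk min_j.
have j_gt0 : (0 < j)%N by case: j le_n_jk {min_j} => //; rewrite leqNgt n_gt0.
have lt_jk : (j.-1 * k < n)%N.
  by rewrite ltnNge; apply/negP => /min_j; rewrite leqNgt prednK ?leqnn.
have jkE : (j * k = k + j.-1 * k)%N by rewrite -{1}(prednK j_gt0) mulSn.
exists j.
  (* If [n <= j], then [(j - 1) k < n] and [2 <= k] would give [2 (n - 1) < n], against [1 < n]. *)
  by nia.
pose r := (j * k - n)%N.
(* The excess [r] is below [k], so one replacement of [x^n] by [b] suffices: the result has degree
   at most [r + 1 <= k < n]. *)
have lt_rk : (r < k)%N by rewrite ltn_subLR // jkE addnC ltn_add2r.
have lt_r1n : (r.+1 < n)%N by exact: leq_ltn_trans lt_rk lt_kn.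
case: bB1 => b1 [b0 [b1U b0U bE]].
pose q := (alpha ^+ j * b1) *: 'X^(r.+1) + (alpha ^+ j * b0) *: 'X^r.
have -> : in_qpoly ('X^n - b) ((alpha *: 'X^k) ^+ j) = in_qpoly ('X^n - b) q.
  rewrite exprZn -exprM mulnC -(subnK le_n_jk) exprD -/r linearZ rmorphM /=.
  rewrite in_qpolyXn // -rmorphM /= -linearZ /=; congr in_qpoly.
  rewrite bE mulrDr scalerDr -mul_polyC [_ * (b1 *: _)]mulrC.
  rewrite -!mul_polyC /q -!mul_polyC !polyCM exprS; ring.
have sq : (size q <= n)%N.
  apply/leq_sizeP => i le_ni; have lt_i := leq_trans lt_r1n le_ni.
  by rewrite !coefE !gtn_eqF ?mulr0 ?addr0 // ltnW.
rewrite /hamming_weight in_qpoly_XnsubP // (count_coef_neq0 sq).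
rewrite (bigD1 (Ordinal lt_r1n)) //= (bigD1 (Ordinal (ltnW lt_r1n))) /=; last first.
  by rewrite -val_eqE /= ltn_eqF.
rewrite big1 => [|i /andP[]]; last first.
  rewrite -!val_eqE /= => /negPf ir1 /negPf ir.
  by rewrite !coefE ir ir1 !mulr0 addr0 eqxx.
rewrite !coefE !eqxx gtn_eqF // ltn_eqF // !mulr0 !mulr1 add0r !addr0.
(* Cancelling the units [b1] and [b0], the two coefficients vanish exactly when [alpha^j] does,
   which can happen even for nonzero [alpha]; hence weight 0 or 2. *)
have unit_eq0 (x u : R) : u \is a GRing.unit -> (x * u == 0) = (x == 0).
  by move=> uU; apply: mulIr_eq0; apply: mulIr.
by rewrite !unit_eq0 //; case: eqP.
Qed.

Lemma n_isometric_equivalent a b :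
  B1 a -> B1 b -> n_isometric n a b -> n_equivalent n a b.
Proof.
move=> aB1 bB1 [phi [phi_bij phi_dist]].
have [sa sb] := (size_B1 aB1, size_B1 bB1).
have phi_wt u : hamming_weight (phi u) = hamming_weight u.
  by have := phi_dist u 0; rewrite /hamming_dist raddf0 !subr0.
have wtXn j : (j < n)%N -> hamming_weight (in_qpoly ('X^n - a) 'X^j) = 1%N.
  move=> lt_jn; rewrite /hamming_weight in_qpoly_XnsubP ?size_polyXn //.
  by rewrite -['X^j]scale1r count_coefZXn oner_eq0.
have [k phiX] : exists k, phi (in_qpoly _ 'X) =
    (phi (in_qpoly _ 'X) : {poly R})`_k *: 'X^k :> {poly R}.
  by apply: count_coef_eq1; have := phi_wt (in_qpoly _ 'X^1); rewrite wtXn.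
move: phiX; set alpha := _`_k => phiX.
have phiXE : phi (in_qpoly _ 'X) = in_qpoly _ (alpha *: 'X^k).
  by rewrite -phiX in_qpoly_val.
(* For [n <= k] the coefficient [alpha] would be a default zero, and [phi x] would have weight 0. *)
have lt_kn : (k < n)%N.
  rewrite ltnNge; apply/negP => le_nk; have := phi_wt (in_qpoly _ 'X^1).
  rewrite wtXn // /hamming_weight phiX /alpha nth_default ?scale0r ?polyseq0 //.
  by rewrite (leq_trans _ le_nk) // (size_qpoly_XnsubP sb).
(* If [k = 0], then [phi] sends both [x] and the constant [alpha] to [alpha]; as [n >= 2], these are
   distinct reduced representatives. *)
have k_gt0 : (0 < k)%N.
  rewrite lt0n; apply/eqP => k0; have : 'X = alpha%:P :> {poly R}.
    have sX : (size ('X : {poly R}) <= n)%N by rewrite size_polyX.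
    have sA : (size (alpha%:P) <= n)%N by rewrite (leq_trans (size_polyC_leq1 _)).
    rewrite -(in_qpoly_XnsubP sa n_gt0 sX) -(in_qpoly_XnsubP sa n_gt0 sA).
    congr (polyn _); apply: (bij_inj phi_bij).
    by rewrite phiXE (lrmorph_in_qpoly _ phiXE) comp_polyC k0 -alg_polyC.
  by move=> /polyP/(_ 1); rewrite coefX coefC /=; apply/eqP/oner_neq0.
have k1 : k = 1%N.
  apply/eqP; rewrite eqn_leq k_gt0 andbT leqNgt; apply/negP => k_gt1.
  have [|j lt_jn] := @pow_weight_neq1 b alpha k bB1; first by rewrite k_gt1.
  by case; rewrite rmorphXn /= -phiXE -!rmorphXn /= phi_wt wtXn.
have phiE f : phi (in_qpoly _ f) = in_qpoly _ (f \Po (alpha *: 'X)).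
  by apply: lrmorph_in_qpoly; rewrite phiXE k1.
exists alpha; split; last by exists phi.
(* With [u] the preimage of [x], comparing coefficients of degree 1 in [u(alpha x) = x] exhibits
   [u_1] as an inverse of [alpha]. *)
have [psi _ psiK] := phi_bij; set u := psi (in_qpoly _ 'X).
have su : (size (u : {poly R}) <= n)%N by exact: (size_qpoly_XnsubP sa).
have := psiK (in_qpoly _ 'X); rewrite -/u -[u]in_qpoly_val phiE.
move=> /(congr1 (fun v : {poly %/ 'X^n - b} => (v : {poly R})`_1)).
rewrite !in_qpoly_XnsubP ?size_polyX //; last first.
  apply/leq_sizeP => i le_ni.
  by rewrite coef_comp_polyZX nth_default ?mul0r // (leq_trans su).
rewrite coef_comp_polyZX coefX /= expr1 => u1alpha.
by apply/unitrPr; exists (u : {poly R})`_1; rewrite mulrC.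
Qed.

End Binomials.

Local Close Scope ring_scope.

Theorem theorem6 (R : finComUnitRingType) (p m n : nat)
    (hR : finite_chain_ring R) (hp : prime p) (hm : 1 < m)
    (hchar : has_characteristic R (p ^ m)) (hn : 2 <= n)
    (a b : {poly R}) (ha : B1 a) (hb : B1 b) :
  n_isometric n a b <-> n_equivalent n a b.
Proof.
split; first exact: n_isometric_equivalent.
by apply: n_equivalent_isometric => //; apply: size_B1.
Qed.
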